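(* For every taut set $T\subseteq\mathbb{N}$ that is not Besicovitch, there exists $B\subseteq\mathbb{N}$ such that $B'=T$ and $\overline{d}(\mathcal{M}_{B'}\setminus\mathcal{M}_B)>0$.
   Context: $\mathbb{N}=\{1,2,\dots\}$. For $B\subseteq\mathbb{N}$ let $\mathcal{M}_B=\bigcup_{b\in B}b\mathbb{Z}$ be its set of multiples. For $A\subseteq\mathbb{Z}$, the upper natural density is $\overline{d}(A)=\limsup_{n\to\infty}\frac1n|A\cap[1,n]|$, the natural density $d(A)$ is the corresponding limit (if it exists), and the logarithmic density is $\delta(A)=\lim_{n\to\infty}\frac{1}{\ln n}\sum_{1\le k\le n,\,k\in A}\frac1k$; $\delta(\mathcal{M}_B)$ exists for every $B\subseteq\mathbb{N}$ (Davenport--Erdős). $B$ is Besicovitch if $d(\mathcal{M}_B)$ exists. $B$ is taut if $\delta(\mathcal{M}_{B\setminus\{b\}})<\delta(\mathcal{M}_B)$ for every $b\in B$. $B$ is Behrend if $B\subseteq\mathbb{N}\setminus\{1\}$ and $\delta(\mathcal{M}_B)=1$. $B^{prim}=B\setminus\bigcup_{k\ge2}kB$. For $c\in\mathbb{N}$ and $A\subseteq\mathbb{N}$, $cA=\{ca:a\in A\}$. Tautification: put $C(B)=\{c\in\mathbb{N}: cA\subseteq B\text{ for some Behrend set }A\}$; the tautification of $B$ is $B'=(B\cup C(B))^{prim}$. (Equivalently, $B'$ is the unique taut set whose Mirsky measure equals that of $B$, where the Mirsky measure of $B$ is the shift-invariant measure on $\{0,1\}^{\mathbb{Z}}$ for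 which $\mathbf{1}_{\mathbb{Z}\setminus\mathcal{M}_B}$ is quasi-generic along any sequence realizing the lower density of $\mathcal{M}_B$.) *)

(* Defs.v *)
From mathcomp Require Import all_boot all_order all_algebra.
From mathcomp Require Import all_classical all_reals all_analysis.
Set Implicit Arguments.
Unset Strict Implicit.
Unset Printing Implicit Defensive.
Import Order.TTheory GRing.Theory Num.Theory.
Import numFieldNormedType.Exports.
Local Open Scope classical_set_scope.
Local Open Scope ring_scope.

(* Sets of positive integers are sets of [nat] contained in [posn]; sets of
   multiples are subsets of [int], as are the arguments of the densities. *)
Definition posn : set nat := [set n | (0 < n)%N].

Definition multiples (B : set nat) : set int :=
  \bigcup_(b in B) range (fun z : int => b%:Z * z).

(* At n = 0 the quotient is 0 (as 0^-1 = 0), which affects no limit. *)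
Definition density_seq (R : realType) (A : set int) (n : nat) : R :=
  n%:R^-1 * (\sum_(1 <= k < n.+1 | k%:Z \in A) 1)%N%:R.

Definition upper_density (R : realType) (A : set int) : \bar R :=
  limn_esup (fun n => (density_seq R A n)%:E).

Definition log_density_seq (R : realType) (A : set int) (n : nat) : R :=
  (ln n%:R)^-1 * \sum_(1 <= k < n.+1 | k%:Z \in A) k%:R^-1.

(* A total function, as [limn] has a junk value on divergent sequences. It is
   only applied to sets of multiples, for which the limit always exists by the
   Davenport-Erdos theorem. *)
Definition log_density (R : realType) (A : set int) : R :=
  limn (log_density_seq R A).

Definition besicovitch (R : realType) (B : set nat) : Prop :=
  cvgn (density_seq R (multiples B)).

Definition taut (R : realType) (B : set nat) : Prop :=
  forall b, B b ->
    log_density R (multiples (B `\ b)) < log_density R (multiples B).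

Definition behrend (R : realType) (B : set nat) : Prop :=
  B `<=` posn `\ 1%N /\ log_density R (multiples B) = 1.

Definition dilate (c : nat) (A : set nat) : set nat :=
  [set (c * a)%N | a in A].

Definition prim (B : set nat) : set nat :=
  B `\` \bigcup_(k in [set k | (2 <= k)%N]) dilate k B.

Definition behrend_factors (R : realType) (B : set nat) : set nat :=
  [set c | posn c /\ exists A, behrend R A /\ dilate c A `<=` B].

Definition tautification (R : realType) (B : set nat) : set nat :=
  prim (B `|` behrend_factors R B).

(* Main.v *)
(* Take B = {t p : t in T, p prime, p > h t} with h growing fast. The primes
   beyond any bound K form a Behrend set, since the reciprocals of the K-smooth
   numbers have a finite sum; so T is contained in C(B).

   Conversely let c A be contained in B with A Behrend, and suppose that no
   element of T divides c. If c a = t p, then either p divides c, which bounds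
   a, or c divides t. So up to finitely many elements A consists of multiples of
   E = {e : c e in T}. Removing finitely many elements > 1 from a set does not
   change whether its non-multiples have logarithmic density 0 (sieving a
   divisor-closed set by a > 1 loses at most half of its reciprocal sum), hence
   M_(E minus e) has logarithmic density 1 for any e in E, and so T and T minus
   c e have sets of multiples of equal logarithmic density, against tautness.

   For the upper density: the finite truncations of T have periodic sets of
   multiples, so if T is not Besicovitch there is a fixed eps such that, for
   every K, M_T exceeds M_(T cap [1, K]) by a proportion eps on some [1, n] with
   n > K. Iterating K |-> n gives a sequence N, and h = N works: on
   [1, N_(k+1)] the elements t > N_k of T contribute nothing to M_B. *)
Require Import Defs.
From mathcomp Require Import all_boot all_order all_algebra.
From mathcomp Require Import all_classical all_reals all_analysis.
From mathcomp Require Import zify ring lra.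
Import Order.TTheory GRing.Theory Num.Theory.
Import numFieldNormedType.Exports.
Local Open Scope classical_set_scope.
Local Open Scope ring_scope.

(** * Reciprocal sums, sieving, and sets of logarithmic density zero *)

Definition recip_sum (R : realType) (F : set nat) (n : nat) : R :=
  \sum_(1 <= k < n.+1 | k \in F) k%:R^-1.

Definition nonmultiples (A : set nat) : set nat :=
  [set x | forall a, A a -> ~~ (a %| x)%N].

(** The K-rough numbers. Excluding all divisors in (1, K], not only primes, lets an induction on K
    sieve by one integer at a time. *)
Definition rough (K : nat) : set nat :=
  [set x | forall a, (1 < a <= K)%N -> ~~ (a %| x)%N].

Definition divisor_closed (F : set nat) : Prop :=
  forall x y, (y %| x)%N -> F x -> F y.

Definition log_null (R : realType) (F : set nat) : Prop :=
  (ln n%:R)^-1 * recip_sum R F n @[n --> \oo] --> (0 : R).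

Lemma multiplesE (B : set nat) (k : nat) :
  multiples B k%:Z <-> exists2 b, B b & (b %| k)%N.
Proof.
split=> [[b Bb [z _ /(congr1 absz)]]|[b Bb /dvdnP[q ->]]].
  by rewrite abszM !absz_nat => <-; exists b => //; exact: dvdn_mulr.
by exists b => //; exists q%:Z => //; rewrite mulrC -PoszM.
Qed.

Lemma nonmultiplesP (A : set nat) (x : nat) :
  nonmultiples A x <-> ~ multiples A x%:Z.
Proof.
rewrite multiplesE; split=> [h [b Ab]|h a Aa]; first exact/negP/h.
by apply/negP => ax; apply: h; exists a.
Qed.

Lemma nonmultiples_divisor_closed (A : set nat) :
  divisor_closed (nonmultiples A).
Proof.
move=> x y yx Fx a Aa; apply/negP => ay.
by move/negP: (Fx a Aa); apply; exact: dvdn_trans yx.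
Qed.

Section RecipSum.
Variable R : realType.
Implicit Types (F G : set nat) (n : nat).

Lemma recip_sumS F n :
  recip_sum R F n.+1 = recip_sum R F n + (if n.+1 \in F then n.+1%:R^-1 else 0).
Proof. by rewrite /recip_sum big_mkcond big_nat_recr//= -big_mkcond. Qed.

Lemma recip_sum0 F : recip_sum R F 0 = 0.
Proof. by rewrite /recip_sum big_geq. Qed.

Lemma recip_sum_ge0 F n : 0 <= recip_sum R F n.
Proof. by apply: sumr_ge0 => k _; rewrite invr_ge0. Qed.

Lemma recip_sum_le_length F m n : (m <= n)%N -> recip_sum R F m <= recip_sum R F n.
Proof.
move=> /subnK <-; elim: (n - m)%N => // k ih.
by rewrite addSn recip_sumS (le_trans ih)// lerDl; case: ifP.
Qed.

Lemma recip_sum_subset F G n :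
  {in posn, forall x, F x -> G x} -> recip_sum R F n <= recip_sum R G n.
Proof.
move=> FG; elim: n => [|n ih]; first by rewrite !recip_sum0.
rewrite !recip_sumS lerD//; case: ifPn => [/set_mem Fn|_].
  by rewrite mem_set//; apply: FG => //; exact: mem_set.
by case: ifP.
Qed.

Lemma recip_sum_eq F G n :
  {in posn, forall x, F x <-> G x} -> recip_sum R F n = recip_sum R G n.
Proof.
by move=> FG; apply/le_anti/andP; split; apply: recip_sum_subset => x /FG[].
Qed.

Lemma recip_sumC F G n :
  recip_sum R F n = recip_sum R (F `&` G) n + recip_sum R (F `\` G) n.
Proof.
elim: n => [|n ih]; first by rewrite !recip_sum0 addr0.
rewrite !recip_sumS ih addrACA; congr (_ + _).
by rewrite in_setI in_setD; case: (_ \in F); case: (_ \in G); rewrite ?addr0 ?add0r.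
Qed.

Lemma recip_sum_dilate F G a n : (0 < a)%N ->
  {in posn, forall x, G x -> (a %| x)%N /\ F (x %/ a)%N} ->
  recip_sum R G n <= a%:R^-1 * recip_sum R F n.
Proof.
(* Cutting [F] at [n %/ a] makes the induction exact: both sides can gain a term only when [a]
   divides [n.+1]. *)
move=> a0 GF; suff: recip_sum R G n <= a%:R^-1 * recip_sum R F (n %/ a)%N.
  move=> /le_trans; apply; rewrite ler_wpM2l ?invr_ge0//.
  exact/recip_sum_le_length/leq_div.
elim: n => [|n ih]; first by rewrite div0n !recip_sum0 mulr0.
rewrite recip_sumS divnS//; have [an|an] := boolP (a %| n.+1)%N; last first.
  by rewrite memNset ?addr0// => /GF []; rewrite ?(negPf an)//; exact: mem_set.
rewrite add1n recip_sumS mulrDr lerD//; case: ifPn => [/set_mem Gn|_].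
  have [_ Fn] := GF _ (mem_set (ltn0Sn n)) Gn.
  have e : (n %/ a).+1 = (n.+1 %/ a)%N by rewrite divnS// an.
  by rewrite e mem_set// -invfM -natrM mulnC divnK.
by rewrite mulr_ge0 ?invr_ge0//; case: ifP.
Qed.

(** The discarded elements are [a] times elements of [F], by divisor-closedness, so they carry at
    most 1/a <= 1/2 of the sum. *)
Lemma recip_sum_sieve F a n : (1 < a)%N -> divisor_closed F ->
  recip_sum R F n <= 2 * recip_sum R (F `&` [set x | ~~ (a %| x)%N]) n.
Proof.
move=> a1 dF; have a0 : (0 < a)%N by apply: ltnW.
set G := F `&` _; have := recip_sumC F [set x | ~~ (a %| x)%N] n.
rewrite -/G => e.
have : recip_sum R (F `\` [set x | ~~ (a %| x)%N]) n <= a%:R^-1 * recip_sum R F n.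
  apply: recip_sum_dilate => // x _ [Fx /= /negP]; rewrite negbK => ax.
  by split => //; apply: dF Fx; apply/dvdnP; exists a; rewrite mulnC divnK.
have : a%:R^-1 * recip_sum R F n <= 2^-1 * recip_sum R F n.
  rewrite ler_wpM2r ?recip_sum_ge0// lef_pV2 ?posrE ?ltr0n// ler_nat//.
by lra.
Qed.

Lemma recip_sum_rough F K n : divisor_closed F ->
  recip_sum R F n <= 2 ^+ K * recip_sum R (F `&` rough K) n.
Proof.
elim: K F => [|K ih] F dF.
  rewrite expr0 mul1r; apply: recip_sum_subset => x _ Fx; split => // a.
  by case: a => // a /andP[].
(* The sieve needs a divisor above 1. At K = 0 the next divisor is 1, and [rough 1] excludes
   nothing. *)
have [->|K0] := posnP K.
  rewrite (@le_trans _ _ (recip_sum R (F `&` rough 1) n))//.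
    by apply: recip_sum_subset => x _ Fx; split => // a; lia.
  by rewrite ler_peMl ?recip_sum_ge0// exprn_ege1// ler1n.
have dG : divisor_closed (F `&` [set x | ~~ (K.+1 %| x)%N]).
  move=> x y yx [Fx /= Kx]; split; first exact: dF Fx.
  by apply: contra Kx => /dvdn_trans; exact.
rewrite (le_trans (recip_sum_sieve F K.+1 n _ dF))// exprS -mulrA ler_pM2l//.
rewrite (le_trans (ih _ dG))// ler_wpM2l ?exprn_ge0//.
apply: recip_sum_subset => x _ [[Fx /= Kx] Hx]; split => // a.
rewrite (leq_eqVlt a) => /andP[a1 /orP[/eqP ->//|aK]].
by apply: Hx; rewrite a1.
Qed.

Lemma cvg_inv_ln : (ln n%:R)^-1 @[n --> \oo] --> (0 : R).
Proof.
apply/gtr0_cvgV0.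
  by near=> n; rewrite ln_gt0// ltr1n; near: n; exact: nbhs_infty_gt.
apply/cvgryPge => A; near=> n.
rewrite -[A]expRK ler_ln ?posrE ?expR_gt0//.
  by near: n; exact: nbhs_infty_ger.
by rewrite ltr0n; near: n; exact: nbhs_infty_gt.
Unshelve. all: by end_near. Qed.

Lemma log_null_bounded F (C : R) : (forall n, recip_sum R F n <= C) -> log_null R F.
Proof.
move=> FC.
have n0 : (fun=> 0 : R) @ \oo --> (0 : R) by exact: cvg_cst.
have nC : (fun n => (ln n%:R)^-1 * C) @ \oo --> (0 : R).
  by rewrite -[X in _ --> X](mul0r C); apply: cvgM; [exact: cvg_inv_ln|exact: cvg_cst].
apply: (squeeze_cvgr _ n0 nC); near=> n.
have lnp : 0 <= (ln (n%:R : R))^-1.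
  by rewrite invr_ge0 ln_ge0// ler1n; near: n; exact: nbhs_infty_gt.
by rewrite mulr_ge0 ?recip_sum_ge0//= ler_wpM2l.
Unshelve. all: by end_near. Qed.

Lemma log_null_le F G (C : R) :
  (forall n, recip_sum R G n <= C * recip_sum R F n) -> log_null R F -> log_null R G.
Proof.
move=> GF nF.
have n0 : (fun=> 0 : R) @ \oo --> (0 : R) by exact: cvg_cst.
have nCF : (fun n => C * ((ln n%:R)^-1 * recip_sum R F n)) @ \oo --> (0 : R).
  by rewrite -[X in _ --> X](mulr0 C); apply: cvgM => //; exact: cvg_cst.
apply: (squeeze_cvgr _ n0 nCF); near=> n.
have lnp : 0 <= (ln (n%:R : R))^-1.
  by rewrite invr_ge0 ln_ge0// ler1n; near: n; exact: nbhs_infty_gt.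
by rewrite mulr_ge0 ?recip_sum_ge0//= mulrCA ler_wpM2l.
Unshelve. all: by end_near. Qed.

(** Both bounds follow by induction from ln (1 + x) <= x, with x = 1/(n+1) for the lower one and x =
    -1/(n+2) for the upper one. *)
Lemma recip_sum_posn_ln n :
  ln n.+1%:R <= recip_sum R posn n /\ recip_sum R posn n.+1 <= 1 + ln n.+1%:R.
Proof.
elim: n => [|n [ih1 ih2]].
  by rewrite !recip_sumS !recip_sum0 ln1 mem_set// invr1 add0r addr0.
have n1 : 0 < n.+1%:R :> R by [].
have n2 : 0 < n.+2%:R :> R by [].
rewrite (recip_sumS posn n.+1) mem_set//; split.
  rewrite recip_sumS mem_set//.
  have -> : n.+2%:R = n.+1%:R * (1 + n.+1%:R^-1) :> R.
    by rewrite mulrDr mulr1 divff ?gt_eqF// natr1.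
  rewrite lnM ?posrE ?addr_gt0 ?invr_gt0// lerD//.
  by rewrite le_ln1Dx// (lt_trans (ltrN10 R))// invr_gt0.
have e : n.+1%:R = n.+2%:R * (1 + - n.+2%:R^-1) :> R.
  by rewrite mulrDr mulrN mulr1 divff ?gt_eqF// -(addn1 n.+1) natrD addrK.
have lt1 : n.+2%:R^-1 < 1 :> R by rewrite invf_lt1// ltr1n.
have := @le_ln1Dx R (- n.+2%:R^-1); rewrite ltrN2 => /(_ lt1).
move: ih2; rewrite e lnM ?posrE//; last by rewrite subr_gt0.
move=> h1 h2; rewrite (le_trans (lerD h1 (lexx _)))// -!addrA lerD2l gerDl.
by rewrite -lerBrDr sub0r.
Qed.

Lemma cvg_recip_sum_posn :
  (ln n%:R)^-1 * recip_sum R posn n @[n --> \oo] --> (1 : R).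
Proof.
have c1 : (fun=> 1 : R) @ \oo --> (1 : R) by exact: cvg_cst.
have c2 : (fun n => 1 + (ln n%:R)^-1) @ \oo --> (1 : R).
  by rewrite -[X in _ --> X](addr0 1); apply: cvgD; [exact: c1|exact: cvg_inv_ln].
apply: (squeeze_cvgr _ c1 c2); exists 2%N => // -[//|n] /= n1.
have lnp : 0 < ln (n.+1%:R : R) by rewrite ln_gt0// ltr1n.
have [h1 h2] := recip_sum_posn_ln n.
rewrite ler_pdivlMl// mulr1 ler_pdivrMl// mulrDr mulfV ?gt_eqF// mulr1.
by rewrite addrC (le_trans h1)//=; exact: recip_sum_le_length.
Qed.

Lemma recip_sum_nonmultiples (A : set nat) n :
  recip_sum R [set k | multiples A k%:Z] n =
  recip_sum R posn n - recip_sum R (nonmultiples A) n.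
Proof.
rewrite (recip_sumC posn (nonmultiples A)).
rewrite (recip_sum_eq (posn `&` _) (nonmultiples A)); last first.
  by move=> x /set_mem px; split => [[]|].
rewrite addrAC subrr add0r; apply: recip_sum_eq => x /set_mem px; split.
  by move=> Ax; split => // /nonmultiplesP.
by move=> [_ /nonmultiplesP/contrapT].
Qed.

Lemma log_density_seqE (A : set int) n :
  log_density_seq R A n = (ln n%:R)^-1 * recip_sum R [set k | A k%:Z] n.
Proof. by []. Qed.

Lemma log_density_eq1 (A : set nat) :
  log_density R (multiples A) = 1 <-> log_null R (nonmultiples A).
Proof.
have E n : log_density_seq R (multiples A) n =
    (ln n%:R)^-1 * recip_sum R posn n - (ln n%:R)^-1 * recip_sum R (nonmultiples A) n.
  by rewrite log_density_seqE recip_sum_nonmultiples mulrBr.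
split=> [d1|n0]; last first.
  apply/cvg_lim => //; rewrite (funext E).
  rewrite -[X in _ --> X]subr0; apply: cvgB n0; exact: cvg_recip_sum_posn.
have [c|c] := pselect (cvgn (log_density_seq R (multiples A))).
  rewrite /log_null.
  have -> : (fun n => (ln n%:R)^-1 * recip_sum R (nonmultiples A) n) =
    (fun n => (ln n%:R)^-1 * recip_sum R posn n - log_density_seq R (multiples A) n).
    by apply/funext => n; rewrite E opprB addrC subrK.
  rewrite -[X in _ --> X](subrr 1); apply: cvgB; first exact: cvg_recip_sum_posn.
  by rewrite -d1.
(* On a divergent sequence [limn] is the default point 0, which is not 1. *)
move: d1; rewrite /log_density (dvgP c) => /eqP.
by rewrite eq_sym oner_eq0.
Qed.

End RecipSum.

(** * Tautness and the Behrend factors of prime dilates *)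

Definition prime_dilates (T : set nat) (h : nat -> nat) : set nat :=
  [set x | exists t p, [/\ T t, prime p, (h t < p)%N & x = (t * p)%N]].

Section Taut.
Variable R : realType.

(* This includes divergent sequences: on those [limn] is the default point. *)
Lemma limn_subr0 (u v : R ^nat) : u n - v n @[n --> \oo] --> 0 -> limn u = limn v.
Proof.
move=> uv0; have key (a b : R ^nat) (l : R) :
    a n - b n @[n --> \oo] --> 0 -> b @ \oo --> l -> a @ \oo --> l.
  move=> ab0 bl; rewrite (_ : a = (fun n => a n - b n + b n)); last first.
    by apply/funext => n; rewrite subrK.
  by rewrite -[X in _ --> X]add0r; exact: cvgD.
have vu0 : v n - u n @[n --> \oo] --> 0.
  rewrite (_ : (fun n => v n - u n) = (fun n => - (u n - v n))); last first.
    by apply/funext => n; rewrite opprB.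
  by rewrite -[X in _ --> X]oppr0; exact: cvgN.
have [cv|dv] := pselect (cvgn v); first exact/cvg_lim/(key _ _ _ uv0).
have [/(key _ _ _ vu0) cu|du] := pselect (cvgn u).
  by case: dv; apply/cvg_ex; exists (limn u).
by rewrite (dvgP dv) (dvgP du).
Qed.

Lemma log_density_mod_log_null (S T : set nat) : S `<=` T ->
  log_null R (nonmultiples S `\` nonmultiples T) ->
  log_density R (multiples S) = log_density R (multiples T).
Proof.
move=> ST N0; apply: limn_subr0.
rewrite (_ : (fun n => _) = (fun n => - ((ln n%:R)^-1 *
    recip_sum R (nonmultiples S `\` nonmultiples T) n))).
  by rewrite -[X in _ --> X]oppr0; exact: cvgN.
apply/funext => n; rewrite !log_density_seqE !recip_sum_nonmultiples.
rewrite (recip_sumC _ (nonmultiples S) (nonmultiples T)).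
rewrite (recip_sum_eq _ (_ `&` _) (nonmultiples T)); first by lra.
by move=> x _; split=> [[]//|nT]; split => // s /ST; exact: nT.
Qed.

(** If s <> t, deleting t leaves the set of multiples unchanged, since multiples of t are multiples
    of s. *)
Lemma taut_primitive (T : set nat) s t : taut R T -> T s -> T t ->
  (s %| t)%N -> s = t.
Proof.
move=> tT Ts Tt st; apply: contrapT => /eqP s_t.
have := tT t Tt; suff -> : multiples (T `\ t) = multiples T by rewrite ltxx.
apply/seteqP; split=> x [b Tb [z _ <-]]; first by exists b; [case: Tb|exists z].
have [->|bt] := eqVneq b t; last by exists b; [split=> //; exact/eqP|exists z].
exists s; first by split=> //; exact/eqP.
by move/dvdnP: st => [q ->]; exists (q%:Z * z) => //; rewrite PoszM; ring.
Qed.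

(** A multiple of [T] missed by [T] minus [c * e] is a multiple of [c * e], and its quotient by [c]
    is a nonmultiple of the set in the conclusion. Were these log null, deleting [c * e] would leave
    the logarithmic density unchanged. *)
Lemma taut_quotient (T : set nat) c e : taut R T -> (0 < c)%N -> T (c * e)%N ->
  ~ log_null R (nonmultiples ([set y | T (c * y)%N] `\ e)).
Proof.
move=> tT c0 Tce N0; have := tT _ Tce.
rewrite (@log_density_mod_log_null (T `\ (c * e)%N) T) ?ltxx//.
apply: (@log_null_le _ _ _ c%:R^-1 _ N0) => n; apply: recip_sum_dilate => // x _ [Fx].
have [ [t Tt tx]|nm] := pselect (exists2 t, T t & (t %| x)%N); last first.
  by case=> t Tt; apply/negP => tx; apply: nm; exists t.
move=> _; have cex : (c * e %| x)%N.
  have [<-//|tce] := eqVneq t (c * e)%N.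
  by have /negP := Fx t (conj Tt (elimN eqP tce)).
have cx : (c %| x)%N by rewrite (dvdn_trans _ cex)// dvdn_mulr.
split=> // a [/= Ta ae]; rewrite dvdn_divRL// mulnC; apply: Fx; split => //=.
by move=> /eqP; rewrite eqn_pmul2l// => /eqP.
Qed.

(** The nonmultiples are the K-smooth numbers. Sieving them by 2, ..., K leaves only 1, so their
    reciprocal sum is at most 2 ^ K. *)
Lemma behrend_primes K : behrend R [set p | prime p /\ (K < p)%N].
Proof.
split=> [p [pp _]|]; first by split; [exact: prime_gt0|move=> p1; rewrite p1 in pp].
apply/log_density_eq1/(@log_null_bounded _ _ (2 ^+ K)) => n.
set F := nonmultiples _.
rewrite (le_trans (recip_sum_rough _ F K n _))//.
  exact: nonmultiples_divisor_closed.
rewrite -[leRHS]mulr1 ler_wpM2l ?exprn_ge0//.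
have F1 : {in posn, forall x, (F `&` rough K) x -> x = 1%N}.
  move=> x /set_mem px [Fx Kx]; apply: contrapT => /eqP x1.
  have x2 : (1 < x)%N by rewrite ltn_neqAle eq_sym x1.
  have [Kp|pK] := ltnP K (pdiv x).
    by have /negP := Fx (pdiv x) (conj (pdiv_prime x2) Kp); apply; exact: pdiv_dvd.
  by have := Kx (pdiv x); rewrite pK prime_gt1 ?pdiv_prime// pdiv_dvd => /(_ isT).
rewrite (le_trans (recip_sum_subset _ _ [set 1%N] n F1))//.
elim: n => [|[|n] ih]; first by rewrite recip_sum0.
  by rewrite recip_sumS recip_sum0 mem_set// invr1 add0r.
by rewrite recip_sumS memNset// addr0.
Qed.

Lemma behrend_factors_prime_dilates (T : set nat) (h : nat -> nat) c :
  T `<=` posn -> taut R T -> (forall t, (t <= h t)%N) ->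
  behrend_factors R (prime_dilates T h) c -> exists2 t, T t & (t %| c)%N.
Proof.
move=> T0 tT hT [c0 [A [[A1 dA] cAB]]].
have c0' : (0 < c)%N := c0.
apply: contrapT => ncT.
move: dA => /log_density_eq1 nA.
pose E := [set y | T (c * y)%N].
have E1 e : E e -> (1 < e)%N.
  move=> Ee; rewrite ltnNge; apply/negP => e1; apply: ncT.
  have : posn (c * e)%N by exact: T0.
  rewrite /posn/= muln_gt0 c0'/= => e0.
  by exists (c * e)%N => //; rewrite (_ : e = 1%N) ?muln1//; lia.
have AE a : A a -> (a <= c ^ 2)%N \/ exists2 e, E e & (e %| a)%N.
  move=> Aa; have /cAB [t [p [Tt pp hp e]]] : dilate c A (c * a)%N by exists a.
  have a0 : (0 < a)%N by case: (A1 a Aa).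
  have [pc|pc] := boolP (p %| c)%N.
    (* Here t <= h t < p <= c, so a <= c a = t p <= c ^ 2. *)
    left; have pc' := dvdn_leq c0' pc; have := hT t; nia.
  have ct : (c %| t)%N.
    rewrite -(@Gauss_dvdl c t p); first by rewrite -e dvdn_mulr.
    by rewrite coprime_sym prime_coprime.
  right; exists (t %/ c)%N; first by rewrite /E /= mulnC divnK.
  by rewrite -(dvdn_pmul2l c0') e mulnC divnK// dvdn_mulr.
have sieve (e0 : nat) : (1 < e0)%N -> log_null R (nonmultiples (E `\ e0)).
  (* This [K] lets roughness exclude both the elements of [A] up to c ^ 2 and the multiples of [e0];
     every other element of [A] is a multiple of some e <> e0 in [E]. *)
  move=> e01; pose K := maxn (c ^ 2) e0.
  apply: (@log_null_le _ _ _ (2 ^+ K) _ nA) => n.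
  rewrite (le_trans (recip_sum_rough _ _ K n (nonmultiples_divisor_closed _)))//.
  rewrite ler_wpM2l ?exprn_ge0//; apply: recip_sum_subset => x _ [Fx Kx] a Aa.
  have [a0 a1] := A1 a Aa.
  have a2 : (1 < a)%N by rewrite ltn_neqAle eq_sym a0 andbT; apply/eqP.
  case: (AE a Aa) => [ac|[e Ee ea]]; first by apply: Kx; rewrite a2 leq_max ac.
  apply/negP => /(dvdn_trans ea); apply/negP.
  have [->|ee] := eqVneq e e0; first by apply: Kx; rewrite e01 leq_maxr.
  by apply: Fx; split=> //; exact/eqP.
have [ [e Ee]|nE] := pselect (exists e, E e).
  by apply: (taut_quotient T c e tT c0' Ee); apply: sieve; exact: E1.
(* With [E] empty, [sieve] at an arbitrary number, here 2, would make the set of all positive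
   integers log null. *)
have := sieve 2%N isT; rewrite (_ : E `\ 2%N = set0); last first.
  by apply/seteqP; split => // e [Ee _]; apply: nE; exists e.
have := cvg_recip_sum_posn R.
rewrite (_ : (fun n => _) = (fun n => (ln n%:R)^-1 * recip_sum R (nonmultiples set0) n)).
  move=> /(cvg_lim (@Rhausdorff R)) l1 /(cvg_lim (@Rhausdorff R)) l0.
  by move/eqP: (oner_neq0 R); rewrite -l1 l0.
apply/funext => n; rewrite (recip_sum_eq _ posn (nonmultiples set0))//.
by move=> x /set_mem px; split=> // _ a [].
Qed.

End Taut.

(** * Natural density: periodic sets and the gap left by finite truncations *)

Section NaturalDensity.
Variable R : realType.
Implicit Types A S : set int.

Definition counting_fun A n : nat := (\sum_(1 <= k < n.+1 | k%:Z \in A) 1)%N.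

Lemma density_seqE A n : density_seq R A n = n%:R^-1 * (counting_fun A n)%:R.
Proof. by []. Qed.

Lemma counting_funS A n : counting_fun A n.+1 = (counting_fun A n + (n.+1%:Z \in A))%N.
Proof.
by rewrite /counting_fun big_mkcond big_nat_recr//= -big_mkcond; case: (_ \in A).
Qed.

Lemma counting_fun0 A : counting_fun A 0 = 0%N.
Proof. by rewrite /counting_fun big_geq. Qed.

Lemma counting_fun_le A n : (counting_fun A n <= n)%N.
Proof.
elim: n => [|n ih]; first by rewrite counting_fun0.
by rewrite counting_funS -addn1 leq_add//; case: (_ \in _).
Qed.

Lemma counting_fun_subset S A n : S `<=` A -> (counting_fun S n <= counting_fun A n)%N.
Proof.
move=> SA; elim: n => [|n ih]; first by rewrite !counting_fun0.
rewrite !counting_funS leq_add//; case: (boolP (_ \in S)) => [/set_mem/SA An|//].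
by rewrite mem_set.
Qed.

Lemma counting_fun_periodic A q i r : (forall k : nat, A (k + q)%N%:Z <-> A k%:Z) ->
  counting_fun A (i * q + r) = (i * counting_fun A q + counting_fun A r)%N.
Proof.
move=> Aq; have step n : counting_fun A (n + q) = (counting_fun A n + counting_fun A q)%N.
  elim: n => [|n ih]; first by rewrite counting_fun0 !add0n.
  rewrite addSn !counting_funS ih [RHS]addnAC; congr (_ + nat_of_bool _)%N.
  rewrite -addSn; apply/idP/idP => /set_mem An; apply/mem_set; exact/Aq.
elim: i => [|i ih]; first by rewrite !mul0n !add0n.
by rewrite mulSn -addnA addnC step ih mulSn; lia.
Qed.

Lemma density_periodic A q : (0 < q)%N -> (forall k : nat, A (k + q)%N%:Z <-> A k%:Z) ->
  cvgn (density_seq R A).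
Proof.
move=> q0 Aq; pose f := counting_fun A; pose l : R := (f q)%:R / q%:R.
have iv : (fun n => n%:R^-1 : R) @ \oo --> (0 : R).
  apply/gtr0_cvgV0; last exact: cvgr_idn.
  by near=> n; rewrite ltr0n; near: n; exact: nbhs_infty_gt.
have c1 : (fun n => l - q%:R * n%:R^-1) @ \oo --> l.
  rewrite -[X in _ --> X]subr0 -(mulr0 q%:R); apply: cvgB; first exact: cvg_cst.
  by apply: cvgM => //; exact: cvg_cst.
have c2 : (fun n => l + q%:R * n%:R^-1) @ \oo --> l.
  rewrite -[X in _ --> X]addr0 -(mulr0 q%:R); apply: cvgD; first exact: cvg_cst.
  by apply: cvgM => //; exact: cvg_cst.
apply/cvg_ex; exists l; apply: (squeeze_cvgr _ c1 c2).
exists 1%N => // n /= n0; rewrite density_seqE -/(f n).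
have q0' : 0 < q%:R :> R by rewrite ltr0n.
have n0' : 0 < n%:R :> R by rewrite ltr0n.
(* Writing n = i q + r, the two products differ by |q f(r) - r f(q)| <= q ^ 2, so the density at n
   is within q/n of f(q)/q. *)
have [b1 b2] : (n * f q <= q * f n + q * q /\ q * f n <= n * f q + q * q)%N.
  have e : f n = (n %/ q * f q + f (n %% q))%N.
    by rewrite {1}(divn_eq n q); exact: counting_fun_periodic.
  have := divn_eq n q; rewrite e.
  have : (f (n %% q) <= n %% q)%N by exact: counting_fun_le.
  have : (f q <= q)%N by exact: counting_fun_le.
  have := ltn_pmod n q0; nia.
move: b1 b2; rewrite -!(ler_nat R) !natrD !natrM => b1 b2.
have -> : n%:R^-1 * (f n)%:R = (q%:R * (f n)%:R) / (n%:R * q%:R) :> R.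
  by field; rewrite !gt_eqF.
have -> : l - q%:R * n%:R^-1 = (n%:R * (f q)%:R - q%:R * q%:R) / (n%:R * q%:R).
  by rewrite /l; field; rewrite !gt_eqF.
have -> : l + q%:R * n%:R^-1 = (n%:R * (f q)%:R + q%:R * q%:R) / (n%:R * q%:R).
  by rewrite /l; field; rewrite !gt_eqF.
by rewrite !ler_pM2r ?invr_gt0 ?mulr_gt0// b2 andbT lerBlDr.
Unshelve. all: by end_near. Qed.

Lemma besicovitch_finite (T : set nat) K : T `<=` posn ->
  besicovitch R (T `&` [set t | (t <= K)%N]).
Proof.
move=> T0; apply: (@density_periodic _ K`!); first exact: fact_gt0.
have dv b : (T `&` [set t | (t <= K)%N]) b -> (b %| K`!)%N.
  by move=> [Tb bK]; apply: dvdn_fact; rewrite bK andbT; exact: T0.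
by move=> k; split=> /multiplesE[b Tb bk]; apply/multiplesE; exists b => //;
  move: bk; rewrite dvdn_addl// dv.
Qed.

Lemma density_seq_cover A S1 S2 n :
  (forall k : nat, (0 < k <= n)%N -> A k%:Z -> S1 k%:Z \/ S2 k%:Z) ->
  density_seq R A n <= density_seq R S1 n + density_seq R S2 n.
Proof.
move=> AS; rewrite !density_seqE -mulrDr ler_wpM2l ?invr_ge0// -natrD ler_nat.
elim: n AS => [|n ih] AS; first by rewrite !counting_fun0.
rewrite !counting_funS addnACA leq_add//.
  by apply: ih => k /andP[k0 kn]; apply: AS; rewrite k0 ltnW.
have [An|nAn] := pselect (A n.+1%:Z); last by rewrite memNset.
have [h|h] : S1 n.+1%:Z \/ S2 n.+1%:Z by apply: AS => //; rewrite leqnn.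
  by rewrite (mem_set h) (mem_set An); case: (_ \in S2).
by rewrite (mem_set h) (mem_set An); case: (_ \in S1).
Qed.

(** Without a gap, for each e some truncation approximates the density sequence of [T] to within e /
    2 from some point on. The truncation's sequence converges, so that of [T] is Cauchy. *)
Lemma density_gap (T : set nat) : T `<=` posn -> ~ besicovitch R T ->
  exists2 eps : R, 0 < eps & forall K : nat, exists2 n, (K < n)%N &
    density_seq R (multiples (T `&` [set t | (t <= K)%N])) n + eps <=
    density_seq R (multiples T) n.
Proof.
move=> T0 nB; apply: contrapT => ngap; apply: nB; rewrite /besicovitch.
apply/cauchy_cvgP/cauchy_exP => e e0.
pose d K := density_seq R (multiples (T `&` [set t | (t <= K)%N])).
have [K hK] : exists K : nat, forall n, (K < n)%N ->
    density_seq R (multiples T) n < d K n + e / 2.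
  apply: contrapT => nK; apply: ngap; exists (e / 2); first by rewrite divr_gt0.
  move=> K; apply: contrapT => nn; apply: nK; exists K => n Kn.
  by rewrite ltNge; apply/negP => h; apply: nn; exists n.
have /cvg_ex[l /cvgrPdist_lt/(_ (e / 2))] := besicovitch_finite T K T0.
rewrite divr_gt0// => /(_ isT) dl; exists l; rewrite nbhs_simpl /=; near=> n.
have le1 : d K n <= density_seq R (multiples T) n.
  rewrite /d !density_seqE ler_wpM2l ?invr_ge0// ler_nat; apply: counting_fun_subset.
  by move=> x [t [Tt _]] tx; exists t.
have lt1 : density_seq R (multiples T) n < d K n + e / 2.
  by apply: hK; near: n; exact: nbhs_infty_gt.
have lt2 : `|l - d K n| < e / 2 by near: n; exact: dl.
rewrite /ball/=; move: lt2; rewrite !ltr_norml => /andP[]; lra.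
Unshelve. all: by end_near. Qed.

Lemma upper_density_gt0 A (eps : R) : 0 < eps ->
  (forall K : nat, exists2 n, (K <= n)%N & eps <= density_seq R A n) ->
  (0 < upper_density R A)%E.
Proof.
move=> e0 h; apply: (@lt_le_trans _ _ eps%:E); first by rewrite lte_fin.
(* The limsup is an infimum, over neighbourhoods [V] of infinity, of suprema on [V]; each [V]
   contains a tail starting at some [K]. *)
apply: le_ereal_inf_tmp => _ [V [K _ KV] <-]; have [n Kn en] := h K.
apply: (@le_trans _ _ (density_seq R A n)%:E); first by rewrite lee_fin.
by apply: ereal_sup_ubound; exists n => //; exact: KV.
Qed.

End NaturalDensity.

(** * The tautification of the prime dilates, and the choice of [h] *)

(** [T] lies in C(B), and every element of B or C(B) is a multiple of an element of [T]; as [T] is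
    primitive, it is the primitive part of the union. *)
Lemma tautification_prime_dilates (R : realType) (T : set nat) (h : nat -> nat) :
  T `<=` posn -> taut R T -> (forall t, (t <= h t)%N) ->
  tautification R (prime_dilates T h) = T.
Proof.
move=> T0 tT hT; set B := prime_dilates T h.
have TC : T `<=` behrend_factors R B.
  move=> t Tt; split; first exact: T0.
  exists [set p | prime p /\ (h t < p)%N]; split; first exact: behrend_primes.
  by move=> _ [p [pp hp] <-]; exists t, p.
have CT x : (B `|` behrend_factors R B) x -> exists2 t, T t & (t %| x)%N.
  move=> [[t [p [Tt _ _ ->]]]|]; first by exists t => //; exact: dvdn_mulr.
  exact: behrend_factors_prime_dilates.
have C0 x : (B `|` behrend_factors R B) x -> (0 < x)%N.
  move=> [[t [p [Tt pp _ ->]]]|[]//]; rewrite muln_gt0 (prime_gt0 pp) andbT.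
  exact: T0.
apply/seteqP; split=> x.
  move=> [Bx nx]; have [t Tt /dvdnP[k xk]] := CT x Bx.
  have [k2|] := leqP 2 k.
    by case: nx; exists k => //; exists t => //; right; exact: TC.
  move: (C0 x Bx) Tt; rewrite xk; case: k {xk} => [|[|//]] //.
  by rewrite mul1n.
move=> Tx; split; first by right; exact: TC.
move=> [k /= k2 [y Cy kyx]]; have [t Tt ty] := CT y Cy.
(* Since t divides y and y divides x, primitivity gives t = x, hence x <= y, while x = k y with k >=
   2. *)
have tx : t = x by apply: (taut_primitive R T) => //; rewrite -kyx dvdn_mull.
have := C0 y Cy; have := dvdn_leq (C0 y Cy) ty; rewrite tx -kyx; nia.
Qed.

Theorem proposition3 (R : realType) (T : set nat)
    (T_pos : T `<=` posn) (T_taut : taut R T) (T_nB : ~ besicovitch R T) :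
  exists B : set nat,
    [/\ B `<=` posn,
        tautification R B = T &
        (0 < upper_density R
               (multiples (tautification R B) `\` multiples B))%E].
Proof.
have [eps eps0 /choice[g0 gP]] : exists2 eps : R, 0 < eps & forall K : nat, exists n,
    (K < n)%N /\ density_seq R (multiples (T `&` [set t | (t <= K)%N])) n + eps <=
    density_seq R (multiples T) n.
  have [eps eps0 H] := density_gap R T T_pos T_nB.
  by exists eps => // K; have [n] := H K; exists n.
pose N k := iter k g0 0%N.
have NS k : (N k < N k.+1)%N by exact: (gP (N k)).1.
have leN k : (k <= N k)%N by elim: k => // k /leq_ltn_trans; exact.
have homN : {homo N : i j / (i <= j)%N}.
  by apply: homo_leq => //; [exact: leq_trans|move=> k; exact: ltnW].
have tautB := tautification_prime_dilates R T N T_pos T_taut leN.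
exists (prime_dilates T N); split => //.
  by move=> _ [t [p [/T_pos t0 pp _ ->]]]; rewrite /posn/= muln_gt0 (prime_gt0 pp) andbT.
rewrite tautB; apply: (@upper_density_gt0 R _ eps eps0) => k.
exists (N k.+1); first exact: (leq_trans (leN k) (ltnW (NS k))).
(* Adding the truncated density reduces the bound to the gap at [N k] and a covering: up to
   [N k.+1], each multiple of [T] is a multiple of the truncation or lies outside M_B. *)
rewrite -(lerD2l (density_seq R (multiples (T `&` [set t | (t <= N k)%N])) (N k.+1))).
apply: (le_trans (gP (N k)).2); apply: density_seq_cover => x /andP[x0 xN] Tx.
have [|nx] := pselect (multiples (T `&` [set t | (t <= N k)%N]) x%:Z); first by left.
right; split=> // /multiplesE[_ [t [p [Tt _ Np ->]]] tpx].
(* If t p divides x, then t > N k >= k because x avoids the truncation; hence p > N t >= N (k+1) >=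
   x, which is impossible for a divisor of x > 0. *)
have Nkt : (N k < t)%N.
  rewrite ltnNge; apply/negP => tN; apply: nx; apply/multiplesE.
  by exists t => //; apply: dvdn_trans tpx; exact: dvdn_mulr.
have kt : (k < t)%N by exact: leq_ltn_trans (leN k) Nkt.
have px : (p <= x)%N by apply: dvdn_leq => //; apply: dvdn_trans tpx; exact: dvdn_mull.
by have := leq_trans (leq_trans Np px) (leq_trans xN (homN _ _ kt)); rewrite ltnn.
Qed.
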